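(* Let $\mathcal{A}$ be a $\mathbb{Z}$-arrangement in $\mathbb{R}^n$ of rank $r$. If $q$ is a power of a large enough prime (that is, there is a constant $N=N(\mathcal{A})$ such that the following holds for every power $q$ of every prime greater than $N$), and $\mathcal{A}_q$ is the induced arrangement in $\mathbb{F}_q^{\,n}$, then $$q^{n-r}\,\overline{\chi}_{\mathcal{A}}(q,t)=\sum_{p\in\mathbb{F}_q^{\,n}} t^{h(p)}$$ as polynomials in $t$, where $h(p)$ denotes the number of hyperplanes of $\mathcal{A}_q$ that $p$ lies on.
   Context: A hyperplane arrangement $\mathcal{A}$ in $\mathbb{R}^n$ is a finite set of affine hyperplanes of $\mathbb{R}^n$. A subset $\mathcal{B}\subseteq\mathcal{A}$ is central if its hyperplanes have non-empty intersection (the empty subset is central, with intersection $\mathbb{R}^n$). The rank of a central subset is $r(\mathcal{B})=n-\dim\bigcap\mathcal{B}$, and the rank $r$ of $\mathcal{A}$ is the largest rank of a central subset of $\mathcal{A}$ (equivalently, the dimension of the span of the normal vectors of the hyperplanes in $\mathcal{A}$). The coboundary polynomial of $\mathcal{A}$ is $$\overline{\chi}_{\mathcal{A}}(q,t)=\sum_{\mathcal{B}\subseteq\mathcal{A}\text{ central}} q^{\,r-r(\mathcal{B})}(t-1)^{|\mathcal{B}|}.$$ A $\mathbb{Z}$-arrangement is an arrangement whose hyperplanes are given by equations $c_1x_1+\cdots+c_nx_n=c$ with integer (or rational) coefficients. Fix such defining equations; regarding them as equations over the finite field $\mathbb{F}_q$, they define the hyperplanes of the induced arrangement $\mathcal{A}_q$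 in $\mathbb{F}_q^{\,n}$ (for $q$ a power of a large enough prime these are indeed distinct hyperplanes, one for each hyperplane of $\mathcal{A}$). *)

(* Defs.v *)
From mathcomp Require Import all_boot all_order all_algebra finmap.
From mathcomp Require Import boolp classical_sets reals.
Set Implicit Arguments.
Unset Strict Implicit.
Unset Printing Implicit Defensive.
Import Order.TTheory GRing.Theory Num.Theory.
Local Open Scope classical_set_scope.
Local Open Scope fset_scope.
Local Open Scope ring_scope.

(* An affine hyperplane of K^n, with points written as row vectors. *)
Definition is_hyperplane (K : fieldType) (n : nat) (H : set 'rV[K]_n) : Prop :=
  exists (a : 'rV[K]_n) (b : K),
    a != 0 /\ H = [set x | \sum_(i < n) a 0 i * x 0 i = b].

Definition is_arrangement (K : fieldType) (n : nat)
    (A : {fset set 'rV[K]_n}) : Prop :=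
  forall H, H \in A -> is_hyperplane H.

Definition inter (K : fieldType) (n : nat) (B : {fset set 'rV[K]_n}) :
    set 'rV[K]_n :=
  [set x | forall H, H \in B -> H x].

Definition central (K : fieldType) (n : nat) (B : {fset set 'rV[K]_n}) : bool :=
  `[< inter B !=set0 >].

(* The dimension of an affine subspace x + U is \dim U; sets that are not
   affine subspaces (in particular the empty set) get the dummy value 0. *)
Definition affine_dim (K : fieldType) (n : nat) (S : set 'rV[K]_n) : nat :=
  xget 0%N [set d | exists (x : 'rV[K]_n) (U : {vspace 'rV[K]_n}),
                      S = [set y | y - x \in U] /\ d = \dim U].

Definition central_rank (K : fieldType) (n : nat)
    (B : {fset set 'rV[K]_n}) : nat :=
  (n - affine_dim (inter B))%N.

Definition arr_rank (K : fieldType) (n : nat) (A : {fset set 'rV[K]_n}) : nat :=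
  \max_(B <- fpowerset A | central B) central_rank B.

(* The outer variable of {poly {poly int}} is q and the inner one is t. *)
Definition coboundary (K : fieldType) (n : nat)
    (A : {fset set 'rV[K]_n}) : {poly {poly int}} :=
  \sum_(B <- fpowerset A | central B)
     'X^(arr_rank A - central_rank B) * (('X - 1) ^+ #|` B|)%:P.

(* A pair (c, c0) encodes the equation c_1 x_1 + ... + c_n x_n = c0. It is read
   over K through ratr, which sends u / v in lowest terms to u%:~R / v%:~R: for
   integer coefficients this is reduction modulo the characteristic of K, and
   for rational ones it is meaningful as soon as the characteristic divides no
   denominator. *)
Definition equation (n : nat) : Type := ('rV[rat]_n * rat)%type.

Definition satisfies (K : fieldType) (n : nat) (e : equation n)
    (x : 'rV[K]_n) : bool :=
  \sum_(i < n) ratr (e.1 0 i) * x 0 i == ratr e.2.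

(* A has such a family of equations iff it is a Z-arrangement. *)
Definition defining_equations (R : realType) (n : nat)
    (A : {fset set 'rV[R]_n}) (eqn : set 'rV[R]_n -> equation n) : Prop :=
  forall H, H \in A -> H = [set x | satisfies (eqn H) x].

Definition induced (R : realType) (n : nat) (A : {fset set 'rV[R]_n})
    (eqn : set 'rV[R]_n -> equation n) (F : finFieldType) :
    {fset {set 'rV[F]_n}} :=
  [fset finset (satisfies (K := F) (eqn H)) | H in A].

Definition hcount (F : finFieldType) (n : nat) (Aq : {fset {set 'rV[F]_n}})
    (p : 'rV[F]_n) : nat :=
  #|` [fset S in Aq | p \in S]|.

(* Main.v *)
(* Expanding t^h(p) = ((t - 1) + 1)^h(p) over the subsets of the hyperplanes
   through p and exchanging the sums, the right-hand side becomes the sum over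
   B of (t - 1)^|B| times the number of points of F_q^n common to the hyperplanes
   of B. That number is q^(n - r(B)) or 0 according to whether B is central,
   since in large characteristic the ranks of the coefficient matrix and of the
   augmented matrix of B do not change: a rank factorization over the rationals
   reduces to one over F_q. Comparing these counts for {H} and {H, H'} shows
   moreover that distinct hyperplanes of A stay distinct over F_q. *)
Require Import Defs.
From mathcomp Require Import all_boot all_order all_algebra finmap.
From mathcomp Require Import boolp classical_sets reals.
From mathcomp Require Import finfield.
Set Implicit Arguments.
Unset Strict Implicit.
Unset Printing Implicit Defensive.
Import Order.TTheory GRing.Theory Num.Theory.
Local Open Scope ring_scope.

(** * Rational matrices over fields of large characteristic *)

(** The form in which largeness of the prime is used. It holds for every [N] in characteristic 0 and
    for every [N] below a positive characteristic, so the same lemmas apply to the real field and to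
    the finite one. *)
Definition inverts_upto (N : nat) (K : fieldType) : Prop :=
  forall d : nat, (0 < d <= N)%N -> d%:R != 0 :> K.

Lemma inverts_upto_le (N N' : nat) (K : fieldType) :
  (N <= N')%N -> inverts_upto N' K -> inverts_upto N K.
Proof.
move=> NN' invK d /andP[d0 dN]; apply: invK.
by rewrite d0 (leq_trans dN NN').
Qed.

Lemma inverts_upto_numField (N : nat) (K : numFieldType) : inverts_upto N K.
Proof. by move=> d /andP[d0 _]; rewrite pnatr_eq0 -lt0n. Qed.

Lemma inverts_upto_finField (N l k : nat) (F : finFieldType) :
  prime l -> (N < l)%N -> #|F| = (l ^ k)%N -> inverts_upto N F.
Proof.
move=> l_pr Nl cardF d /andP[d0 dN].
have lF : l \in [pchar F] by exact: card_finPcharP cardF l_pr.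
rewrite -(dvdn_pcharf lF); apply/negP => /(dvdn_leq d0).
by rewrite leqNgt (leq_ltn_trans dN Nl).
Qed.

(* [ratr] is not a ring morphism into a field of positive characteristic, but
   it is one on the subring of rationals whose denominator is invertible. *)
Definition ratr_to (K : fieldType) (x : rat) (y : K) : Prop :=
  (denq x)%:~R != 0 :> K /\ ratr x = y.

(** The fraction need not be in lowest terms: a common factor of [a] and [b] divides [b], so it is
    nonzero in [K] and cancels. *)
Lemma ratr_to_frac (K : fieldType) (a b : int) :
  b%:~R != 0 :> K -> ratr_to (a%:~R / b%:~R) (a%:~R / b%:~R : K).
Proof.
case: divqP => [_|m x m0]; first by rewrite eqxx.
rewrite !intrM mulf_eq0 negb_or => /andP[mK xK]; split=> //.
by rewrite /ratr -mulf_div divff ?mul1r.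
Qed.

Lemma ratr_to0 (K : fieldType) : ratr_to 0 (0 : K).
Proof. by split; rewrite ?oner_eq0 // (ratr_int _ 0). Qed.

Lemma ratr_to1 (K : fieldType) : ratr_to 1 (1 : K).
Proof. by split; rewrite ?oner_eq0 // (ratr_int _ 1). Qed.

Lemma ratr_toD (K : fieldType) (x x' : rat) (y y' : K) :
  ratr_to x y -> ratr_to x' y' -> ratr_to (x + x') (y + y').
Proof.
move=> [dx <-] [dx' <-].
have dQ z : (denq z)%:~R != 0 :> rat by rewrite intr_eq0 denq_eq0.
rewrite -{1}(divq_num_den x) -{1}(divq_num_den x') /ratr !addf_div //.
by rewrite -!intrM -!intrD; apply: ratr_to_frac; rewrite intrM mulf_neq0.
Qed.

Lemma ratr_toM (K : fieldType) (x x' : rat) (y y' : K) :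
  ratr_to x y -> ratr_to x' y' -> ratr_to (x * x') (y * y').
Proof.
move=> [dx <-] [dx' <-].
rewrite -{1}(divq_num_den x) -{1}(divq_num_den x') /ratr !mulf_div.
by rewrite -!intrM; apply: ratr_to_frac; rewrite intrM mulf_neq0.
Qed.

Definition ratr_to_mx (K : fieldType) (m n : nat) (A : 'M[rat]_(m, n)) : Prop :=
  forall i j, (denq (A i j))%:~R != 0 :> K.

Lemma ratr_to_mulmx (K : fieldType) (m n p : nat)
    (A : 'M[rat]_(m, n)) (B : 'M[rat]_(n, p)) :
  ratr_to_mx K A -> ratr_to_mx K B ->
  ratr_to_mx K (A *m B) /\
  map_mx (ratr : rat -> K) (A *m B) = map_mx ratr A *m map_mx ratr B.
Proof.
move=> AK BK.
have AB i j : ratr_to ((A *m B) i j)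
    ((map_mx (ratr : rat -> K) A *m map_mx ratr B) i j).
  rewrite !mxE; apply: (big_ind2 (@ratr_to K)); first exact: ratr_to0.
    by move=> *; exact: ratr_toD.
  by move=> k _; rewrite !mxE; apply: ratr_toM; split.
split=> [i j|]; first by case: (AB i j).
by apply/matrixP => i j; rewrite mxE; case: (AB i j).
Qed.

(** Serves both the identity matrix and the middle factor [pid_mx] of a rank factorization. *)
Lemma ratr_to_natmx (K : fieldType) (m n : nat) (c : 'I_m -> 'I_n -> bool) :
  ratr_to_mx K (\matrix_(i, j) (c i j)%:R) /\
  map_mx (ratr : rat -> K) (\matrix_(i, j) (c i j)%:R) = \matrix_(i, j) (c i j)%:R.
Proof.
split=> [i j|]; last apply/matrixP => i j; rewrite !mxE; case: (c i j).
- by case: (ratr_to1 K).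
- by case: (ratr_to0 K).
- by case: (ratr_to1 K).
- by case: (ratr_to0 K).
Qed.

Lemma ratr_to_mx_exists (m n : nat) (A : 'M[rat]_(m, n)) :
  exists N, forall K, inverts_upto N K -> ratr_to_mx K A.
Proof.
exists (\max_i \max_j `|denq (A i j)|)%N => K invK i j.
rewrite -absz_denq; apply: invK.
rewrite absz_gt0 denq_eq0 /=.
apply: leq_trans (leq_bigmax i).
exact: (leq_bigmax (F := fun j => `|denq (A i j)|%N) j).
Qed.

Lemma ratr_unitmx (K : fieldType) (n : nat) (A : 'M[rat]_n) :
  A \in unitmx -> ratr_to_mx K A -> ratr_to_mx K (invmx A) ->
  map_mx (ratr : rat -> K) A \in unitmx.
Proof.
move=> uA AK VK; have [_ mapAV] := ratr_to_mulmx AK VK.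
suff /mulmx1_unit[] : map_mx (ratr : rat -> K) A *m map_mx ratr (invmx A) = 1%:M by [].
rewrite -mapAV mulmxV //.
have [_] := @ratr_to_natmx K n n (fun i j => i == j).
by congr (map_mx _ _ = _); apply/matrixP => i j; rewrite !mxE.
Qed.

(** [A] is [pid_mx (\rank A)] between two invertible matrices. The bound covers the denominators of
    these and of their inverses, so both stay invertible over [K]. *)
Lemma rank_ratr_exists (m n : nat) (A : 'M[rat]_(m, n)) :
  exists N, forall K : fieldType, inverts_upto N K ->
    \rank (map_mx (ratr : rat -> K) A) = \rank A.
Proof.
have [N1 C] := ratr_to_mx_exists (col_ebase A).
have [N2 CV] := ratr_to_mx_exists (invmx (col_ebase A)).
have [N3 D] := ratr_to_mx_exists (row_ebase A).
have [N4 DV] := ratr_to_mx_exists (invmx (row_ebase A)).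
exists (maxn (maxn N1 N2) (maxn N3 N4)) => K invK.
have {}C : ratr_to_mx K (col_ebase A).
  by apply: C; apply: inverts_upto_le invK; rewrite !leq_max leqnn.
have {}CV : ratr_to_mx K (invmx (col_ebase A)).
  by apply: CV; apply: inverts_upto_le invK; rewrite !leq_max leqnn orbT.
have {}D : ratr_to_mx K (row_ebase A).
  by apply: D; apply: inverts_upto_le invK; rewrite !leq_max leqnn !orbT.
have {}DV : ratr_to_mx K (invmx (row_ebase A)).
  by apply: DV; apply: inverts_upto_le invK; rewrite !leq_max leqnn !orbT.
have [pK pE] := @ratr_to_natmx K m n (fun i j => (i == j :> nat) && (i < \rank A)%N).
have [CpK CpE] := ratr_to_mulmx C pK.
have [_ CpDE] := ratr_to_mulmx CpK D.
have pid (S : pzRingType) : \matrix_(i < m, j < n) ((i == j :> nat) && (i < \rank A)%N)%:R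
    = pid_mx (\rank A) :> 'M[S]_(m, n) by apply/matrixP => i j; rewrite !mxE.
rewrite !pid in pE CpE CpDE.
rewrite -{1}(mulmx_ebase A) CpDE CpE pE.
rewrite mxrankMfree ?row_free_unit ?ratr_unitmx ?row_ebase_unit //.
rewrite (eqmxMfull _ _) ?row_full_unit ?ratr_unitmx ?col_ebase_unit //.
by rewrite rank_pid_mx ?rank_leq_row ?rank_leq_col.
Qed.

(** * Solution sets of linear systems over a field *)

Section AffineSystem.
Variables (K : fieldType) (n m : nat) (M : 'M[K]_(n, m)) (c : 'rV[K]_m).

(** The Rouché-Capelli criterion for row vectors: [c] must lie in the row space of [M]. *)
Lemma solvable_rank :
  (exists x, x *m M = c) <-> \rank (col_mx M c) = \rank M.
Proof.
rewrite -addsmxE.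
have -> : (exists x, x *m M = c) <-> (c <= M)%MS.
  by split=> [[x <-]|/submxP[x ->]]; [exact: submxMl|exists x].
have e : (M + c == M)%MS = (c <= M)%MS.
  by rewrite addsmx_sub submx_refl addsmxSl /= andbT.
have [_ r] := mxrank_leqif_sup (addsmxSl M c).
rewrite -[(c <= M)%MS]andTb -(submx_refl M) -addsmx_sub -r.
by split=> [/eqP->|->].
Qed.

Lemma sub_ker (x y : 'rV[K]_n) :
  x *m M = c -> (y *m M = c) <-> (y - x <= kermx M)%MS.
Proof.
move=> xc; split=> [yc|/sub_kermxP]; last first.
  by rewrite mulmxBl xc => /eqP; rewrite subr_eq0 => /eqP.
by apply/sub_kermxP; rewrite mulmxBl xc yc subrr.
Qed.

Lemma affine_dim_system :
  (exists x, x *m M = c) -> affine_dim [set x | x *m M = c] = (n - \rank M)%N.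
Proof.
move=> [x0 x0c].
(* The kernel as a [vspace]: the rows of [row_base] are free, so this map is injective and the
   dimension of its image is that of its source. *)
pose U := limg (linfun (mulmxr (row_base (kermx M))
    : 'rV_(\rank (kermx M)) -> 'rV[K]_n)).
have inU v : (v \in U) = (v <= kermx M)%MS.
  apply/memv_imgP/idP => [[u _ ->]|].
    by rewrite lfunE /= -(eq_row_base (kermx M)) submxMl.
  rewrite -(eq_row_base (kermx M)) => /submxP[u ->].
  by exists u; rewrite ?memvf // lfunE.
have dimU : \dim U = (n - \rank M)%N.
  rewrite limg_dim_eq ?dimvf /dim /= ?mul1n ?mxrank_ker //.
  apply/eqP; rewrite -subv0; apply/subvP => u.
  rewrite memv_cap memvf memv_ker lfunE /= memv0 => /eqP u0; apply/eqP.
  by apply: (row_free_inj (row_base_free (kermx M))); rewrite /= u0 mul0mx.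
rewrite -dimU; apply: xget_unique.
  by exists x0, U; split=> //; apply/seteqP; split=> y /=; rewrite inU;
    move/(sub_ker _ x0c).
(* [affine_dim] picks an arbitrary presentation of the set as a translate of some [V], so every such
   [V] has to be the kernel. *)
move=> _ [x [V [SV ->]]]; congr (\dim _); apply/vspaceP => v.
have SE y : (y *m M = c) <-> (y - x \in V).
  by have := congr1 (@^~ y) SV => /= ->.
have xc : x *m M = c by apply/SE; rewrite subrr mem0v.
have := sub_ker (v + x) xc; rewrite addrK -inU => vU.
by have := SE (v + x); rewrite addrK => vV; apply/idP/idP => [/vV/vU|/vU/vV].
Qed.

End AffineSystem.

Lemma card_system (F : finFieldType) (n m : nat) (M : 'M[F]_(n, m))
    (c : 'rV[F]_m) :
  (exists x, x *m M = c) -> #|[pred x | x *m M == c]| = (#|F| ^ (n - \rank M))%N.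
Proof.
move=> [x0 x0c].
rewrite -mxrank_ker -[\rank _]mul1n -card_mx.
pose f (u : 'rV[F]_(\rank (kermx M))) := u *m row_base (kermx M) + x0.
have f_inj : injective f.
  by move=> u v /addIr; exact: (row_free_inj (row_base_free (kermx M))).
rewrite -(card_codom f_inj); apply: eq_card => y; rewrite !inE.
apply/eqP/codomP => [/(sub_ker _ x0c)|[u ->]].
  rewrite -(eq_row_base (kermx M)) => /submxP[u yx].
  by exists u; rewrite /f -yx subrK.
by apply/(sub_ker _ x0c); rewrite addrK -(eq_row_base (kermx M)) submxMl.
Qed.

(** The inclusion of nonempty solution sets gives one of kernels, and equal ranks turn the latter
    into an equality. *)
Lemma system_eq (K : fieldType) (n m m' : nat) (M : 'M[K]_(n, m))
    (M' : 'M[K]_(n, m')) (c : 'rV[K]_m) (c' : 'rV[K]_m') :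
  (forall x, x *m M = c -> x *m M' = c') -> (exists x, x *m M = c) ->
  \rank M = \rank M' -> forall x, x *m M' = c' -> x *m M = c.
Proof.
move=> sub [x0 x0c] rk x xc'.
have x0c' := sub _ x0c.
have kk : (kermx M <= kermx M')%MS.
  apply/rV_subP => v vM; rewrite -(addrK x0 v).
  apply/(sub_ker _ x0c')/sub/(sub_ker _ x0c).
  by rewrite addrK.
have := mxrank_leqif_sup kk; rewrite !mxrank_ker rk => -[_].
rewrite eqxx => /esym kk'.
by apply/(sub_ker _ x0c); apply: submx_trans kk'; apply/(sub_ker _ x0c').
Qed.

(** * Uniform bounds and sums over subsets *)

Lemma common_bound (T : eqType) (P : T -> nat -> Prop) (s : seq T) :
  (forall x N N', (N <= N')%N -> P x N -> P x N') ->
  (forall x, exists N, P x N) -> exists N, forall x, x \in s -> P x N.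
Proof.
move=> mono exP; elim: s => [|x s [N PN]]; first by exists 0%N.
have [N' PN'] := exP x; exists (maxn N N') => y; rewrite inE => /predU1P[->|ys].
  by apply: mono PN'; rewrite leq_maxr.
by apply: mono (PN y ys); rewrite leq_maxl.
Qed.

(** Distributing the product of the factors [y + 1], one for each element of [A], yields one
    monomial per subset. *)
Lemma sum_fpowerset (S : comNzRingType) (T : choiceType) (A : {fset T}) (y : S) :
  \sum_(B <- fpowerset A) y ^+ #|` B| = (y + 1) ^+ #|` A|.
Proof.
rewrite big_imfset /=; last first.
  move=> Y Z _ _ /fsetP YZ; apply/setP => x.
  by have := YZ (val x); rewrite !inE.
transitivity (\sum_(Y : {set A}) y ^+ #|Y|).
  rewrite big_enum_cond /=; apply: eq_big => [Y|Y _].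
    by rewrite powersetE finset.subsetT.
  by rewrite card_imfset /= -?cardE //; exact: val_inj.
rewrite cardfE -prodr_const bigA_distr.
apply: eq_bigr => Y _; rewrite -prodr_const big_mkcond; exact: eq_bigr.
Qed.

(** * The rational linear system of a finite set of equations *)

Section System.
Variables (n : nat) (T : choiceType) (eqn : T -> equation n).
Implicit Types (K : fieldType) (B : {fset T}).

(** Equations are columns, because points are row vectors multiplied on the left. *)
Definition coefs B : 'M[rat]_(n, #|{: B}|) :=
  \matrix_(i, j) (eqn (val (enum_val j))).1 0 i.

Definition consts B : 'rV[rat]_(#|{: B}|) :=
  \row_j (eqn (val (enum_val j))).2.

Lemma satisfies_all K B (x : 'rV[K]_n) :
  (forall H, H \in B -> satisfies (eqn H) x) <->
  x *m map_mx ratr (coefs B) = map_mx ratr (consts B).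
Proof.
split=> [sat|/matrixP xM H HB].
  apply/matrixP => i j; rewrite ord1 !mxE.
  rewrite -(eqP (sat _ (fsvalP (enum_val j)))).
  by apply: eq_bigr => k _; rewrite !mxE mulrC.
have := xM 0 (enum_rank [` HB]%fset).
rewrite !mxE enum_rankK /= /satisfies => <-; apply/eqP/eq_bigr => k _.
by rewrite !mxE enum_rankK mulrC.
Qed.

(** Solvability over [K] is expressed by a rank condition over the rationals, which does not mention
    [K] and so links different fields. *)
Lemma system_ratr_exists B : exists N, forall K, inverts_upto N K ->
  \rank (map_mx (ratr : rat -> K) (coefs B)) = \rank (coefs B) /\
  ((exists x : 'rV[K]_n, forall H, H \in B -> satisfies (eqn H) x) <->
   \rank (col_mx (coefs B) (consts B)) = \rank (coefs B)).
Proof.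
have [N rkM] := rank_ratr_exists (coefs B).
have [N' rkMc] := rank_ratr_exists (col_mx (coefs B) (consts B)).
exists (maxn N N') => K invK.
have rkMK : \rank (map_mx (ratr : rat -> K) (coefs B)) = \rank (coefs B).
  by apply: rkM; apply: inverts_upto_le invK; rewrite leq_maxl.
split=> //; rewrite -(rkMc K); last by apply: inverts_upto_le invK; rewrite leq_maxr.
rewrite -rkMK map_col_mx -solvable_rank.
by split=> -[x /satisfies_all]; exists x.
Qed.

End System.

(** * Transfer between the real arrangement and its reduction *)

Lemma hyperplane_neq0 (K : fieldType) (n : nat) (H : set 'rV[K]_n) :
  is_hyperplane H -> exists x, H x.
Proof.
move=> [a [b [/rV0Pn[i ai] ->]]]; exists ((b / a 0 i) *: delta_mx 0 i) => /=.
rewrite (bigD1 i) //= big1 => [|j ji]; last by rewrite !mxE (negPf ji) !mulr0.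
by rewrite !mxE !eqxx mulr1 addr0 mulrC divfK.
Qed.

Section Reduction.
Variables (R : realType) (n : nat) (A : {fset set 'rV[R]_n}).
Variable eqn : set 'rV[R]_n -> equation n.
Hypothesis heqn : defining_equations A eqn.

Lemma inter_system (B : {fset set 'rV[R]_n}) : (B `<=` A)%fset ->
  inter B =
  [set x | x *m map_mx ratr (coefs eqn B) = map_mx ratr (consts eqn B)]%classic.
Proof.
move=> /fsubsetP BA; apply/seteqP; split=> x /=.
  move=> xB; apply/satisfies_all => H HB.
  by have := xB H HB; rewrite {1}(heqn (BA H HB)).
move=> /satisfies_all xB H HB.
by rewrite (heqn (BA H HB)); apply: xB.
Qed.

Lemma central_system (B : {fset set 'rV[R]_n}) : (B `<=` A)%fset ->
  central B <-> exists x : 'rV[R]_n, forall H, H \in B -> satisfies (eqn H) x.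
Proof.
move=> BA; split=> [/asboolP[x]|[x /satisfies_all xB]].
  by rewrite inter_system // => /satisfies_all; exists x.
by apply/asboolP; exists x; rewrite inter_system.
Qed.

Lemma central_rank_system (B : {fset set 'rV[R]_n}) : (B `<=` A)%fset ->
  central B -> central_rank B = \rank (map_mx (ratr : rat -> R) (coefs eqn B)).
Proof.
move=> BA /asboolP[x]; rewrite /central_rank inter_system // => xB.
by rewrite affine_dim_system ?subKn ?rank_leq_row //; exists x.
Qed.

(** Phrased with equations rather than with [induced], since distinctness of the reduced hyperplanes
    is itself deduced from these counts. *)
Definition counts_as (F : finFieldType) (B : {fset set 'rV[R]_n}) : Prop :=
  #|[pred p : 'rV[F]_n | all (fun H => satisfies (eqn H) p) B]| =
  (if central B then #|F| ^ (n - central_rank B) else 0)%N.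

Lemma counts_as_exists : exists N, forall F : finFieldType,
  inverts_upto N F -> forall B, (B `<=` A)%fset -> counts_as F B.
Proof.
pose P B N := (B `<=` A)%fset ->
  forall F : finFieldType, inverts_upto N F -> counts_as F B.
have [|B|N PN] := @common_bound _ P (fpowerset A).
- move=> B N N' NN' PN BA F invF; apply: PN => //; exact: inverts_upto_le invF.
- have [N sys] := system_ratr_exists eqn B.
  exists N => BA F invF; rewrite /counts_as.
  have [rkF solF] := sys _ invF.
  have [rkR solR] := sys _ (@inverts_upto_numField N R).
  (* Centrality over the reals and solvability over [F] meet in the same rational rank condition. *)
  have cF := iff_trans (central_system BA) (iff_trans solR (iff_sym solF)).
  case: ifPn => [cB|/negP cB]; last first.
    apply/eqP; rewrite -leqn0 leqNgt; apply/negP => /card_gt0P[x].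
    by rewrite inE => /allP xB; apply/cB/cF; exists x.
  rewrite central_rank_system // rkR -rkF.
  have [x /satisfies_all xB] := cF.1 cB.
  rewrite -(card_system (c := map_mx ratr (consts eqn B))); last by exists x.
  apply: eq_card => y; rewrite !inE; apply/allP/eqP => /satisfies_all //.
- by exists N => F invF B BA; apply: PN; rewrite ?fpowersetE.
Qed.

(** If the reductions agree, [{H}] and [{H, H'}] have the same number of points over [F]. Hence
    their real ranks agree, and adding the equation of [H'] to that of [H] removes no real point. *)
Lemma reduction_sub (F : finFieldType) H H' :
  is_arrangement A -> (forall B, (B `<=` A)%fset -> counts_as F B) ->
  H \in A -> H' \in A ->
  finset (satisfies (K := F) (eqn H)) = finset (satisfies (K := F) (eqn H')) ->
  forall x, H x -> H' x.
Proof.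
move=> hA cnt HA H'A /setP HH'.
have B1A : ([fset H] `<=` A)%fset by rewrite fsub1set.
have B2A : ([fset H; H'] `<=` A)%fset.
  by apply/fsubsetP => X; rewrite !inE => /orP[] /eqP->.
have sat1 (K : fieldType) (x : 'rV[K]_n) :
    (forall X, X \in [fset H]%fset -> satisfies (eqn X) x) <-> satisfies (eqn H) x.
  by split=> [|sx X]; [apply; rewrite inE|rewrite inE => /eqP->].
have sat2 (K : fieldType) (x : 'rV[K]_n) :
    (forall X, X \in [fset H; H']%fset -> satisfies (eqn X) x) <->
    satisfies (eqn H) x /\ satisfies (eqn H') x.
  split=> [sx|[sx sx'] X]; first by split; apply: sx; rewrite !inE eqxx ?orbT.
  by rewrite !inE => /orP[] /eqP->.
have c1 : central [fset H]%fset.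
  by apply/(central_system B1A); have [x Hx] := hyperplane_neq0 (hA H HA);
    exists x; apply/sat1; move: Hx; rewrite {1}(heqn HA).
have := cnt _ B1A; rewrite /counts_as c1.
have -> : #|[pred p : 'rV[F]_n | all (fun X => satisfies (eqn X) p) [fset H]%fset]|
        = #|[pred p : 'rV[F]_n | all (fun X => satisfies (eqn X) p) [fset H; H']%fset]|.
  apply: eq_card => p; rewrite !inE.
  have := HH' p; rewrite !inE => pp.
  apply/allP/allP => [/sat1 sp|/sat2[sp _]]; last exact/sat1.
  by apply/sat2; rewrite -pp.
(* Were [{H, H'}] not central, its count would be 0, whereas the count for [{H}] is a power of
   [#|F|], hence positive. *)
rewrite cnt //; case: ifP => [c2 /eqP|_ /esym/eqP]; last first.
  by rewrite expn_eq0 -leqn0 leqNgt (cardD1 0).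
rewrite eqn_exp2l ?finNzRing_gt1 // !central_rank_system // => /eqP rk.
move=> x Hx.
have sx : satisfies (eqn H) x by move: Hx; rewrite {1}(heqn HA).
suff /satisfies_all/sat2[_ sx'] : x *m map_mx ratr (coefs eqn [fset H; H']%fset)
    = map_mx ratr (consts eqn [fset H; H']%fset) by rewrite (heqn H'A).
apply: (system_eq (M' := map_mx ratr (coefs eqn [fset H]%fset))).
- by move=> y /satisfies_all/sat2[sy _]; apply/satisfies_all/sat1.
- by have [y /satisfies_all] := (central_system B2A).1 c2; exists y.
- by rewrite -[LHS](subKn (rank_leq_row _)) rk subKn // rank_leq_row.
- exact/satisfies_all/sat1.
Qed.

End Reduction.

(** * The coboundary polynomial as a weighted point count *)

Theorem theorem3p3 (R : realType) (n : nat) (A : {fset set 'rV[R]_n})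
    (hA : is_arrangement A)
    (eqn : set 'rV[R]_n -> equation n) (heqn : defining_equations A eqn) :
  exists N : nat,
  forall (l k : nat), prime l -> (N < l)%N -> (0 < k)%N ->
  forall F : finFieldType, #|F| = (l ^ k)%N ->
    let q : {poly int} := (l ^ k)%:R in
    q ^+ (n - arr_rank A) * (coboundary A).[q]
      = \sum_(p : 'rV[F]_n) 'X^(hcount (induced A eqn F) p).
Proof.
have [N cnt] := counts_as_exists heqn; exists N => l k l_pr Nl _ F cardF q.
have {}cnt := cnt F (inverts_upto_finField l_pr Nl cardF).
pose V (p : 'rV[F]_n) := [fset H in A | satisfies (eqn H) p]%fset.
have VE p B : (B `<=` A)%fset ->
    (B `<=` V p)%fset = all (fun H => satisfies (eqn H) p) B.
  move=> /fsubsetP BA; apply/fsubsetP/allP => [BV H /BV|sB H HB].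
    by rewrite !inE => /andP[].
  by rewrite !inE BA //=; apply: sB.
(* [hcount] counts distinct subsets of the finite space, so returning to hyperplanes of [A] requires
   reduction to be injective on [A]. *)
have hcountE p : hcount (induced A eqn F) p = #|` V p|.
  have red_inj : {in A &, injective (fun H => finset (satisfies (K := F) (eqn H)))}.
    by move=> H H' HA H'A HH'; apply/seteqP; split; apply: (reduction_sub heqn hA cnt).
  rewrite /hcount.
  have -> : [fset S in induced A eqn F | p \in S]%fset =
      [fset finset (satisfies (K := F) (eqn H)) | H in V p]%fset.
    apply/fsetP => S; rewrite !inE /=; apply/andP/imfsetP.
      move=> [/imfsetP[H /= HA ->]]; rewrite inE => sp.
      by exists H; rewrite // !inE HA.
    move=> [H /=]; rewrite !inE => /andP[HA sp] ->; rewrite inE; split=> //.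
    by apply/imfsetP; exists H.
  rewrite card_in_imfset // => H H'.
  by rewrite !inE => /andP[HA _] /andP[H'A _]; apply: red_inj.
have expand p : 'X^(hcount (induced A eqn F) p) =
    \sum_(B <- fpowerset A | (B `<=` V p)%fset) ('X - 1) ^+ #|` B| :> {poly int}.
  rewrite hcountE -[X in X ^+ _](subrK 1) -sum_fpowerset.
  rewrite [RHS]big_fset_condE; apply: eq_fbigl => B.
  rewrite !inE !fpowersetE andb_idl // => /fsubset_trans; apply.
  by apply/fsubsetP => H; rewrite !inE => /andP[].
rewrite (eq_bigr _ (fun p _ => expand p)) (exchange_big_dep xpredT) //=.
(* Both sides become sums over all subsets of [A], compared term by term; a non-central one
   contributes 0 on the left and has no common point on the right. *)
rewrite /coboundary horner_sum mulr_sumr big_mkcond big_seq [RHS]big_seq.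
apply: eq_bigr => B; rewrite fpowersetE => BA.
rewrite (eq_bigl (mem [pred p : 'rV[F]_n | all (fun H => satisfies (eqn H) p) B]));
  last by move=> p; rewrite !inE VE.
rewrite sumr_const cnt //; case: ifP => // cB.
rewrite hornerM horner_exp hornerX hornerC mulrA -exprD mulrC -mulr_natr.
rewrite cardF natrX; congr (_ * _).
(* These two bounds keep the natural-number subtractions from truncating, so that the exponents
   [n - r] and [r - r(B)] add up to [n - r(B)]. *)
have Br : (central_rank B <= arr_rank A)%N.
  by apply: (leq_bigmax_seq B) => //; rewrite fpowersetE.
have rn : (arr_rank A <= n)%N.
  by apply/bigmax_leqP_seq => *; exact: leq_subr.
by rewrite /q natrX addnBA // subnK.
Qed.
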